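(* Let $N\ge1$ be an integer, $\mathcal X=\{0,1,\dots,N\}$, $a_1,b_1,a_2,b_2>0$, and let, for $x,y\in\mathcal X$, $$K(x,y)=\sum_{z_2=0}^{\min(x,y)}\pi(z_2,y,a_1,b_1)\sum_{z_1=\max(x,y)}^{N}\pi(x-z_2,z_1-z_2,b_1,a_2)\,\pi(z_1-y,N-y,a_2,b_2),$$ where $\pi$ is the Hahn measure. Then $K(x,y)\ge0$, $\sum_{x\in\mathcal X}K(x,y)=1$, and with $\lambda=(a_1+b_1,a_2+b_2)$ one has, for all $x,y,n\in\mathcal X$, $$K(x,y)\,\pi(y,N,\lambda)=K(y,x)\,\pi(x,N,\lambda),$$ $$\sum_{y\in\mathcal X}K(x,y)\,\pi(y,N,\lambda)\,\check P_n(y,\lambda)=\kappa(n)\,\pi(x,N,\lambda)\,\check P_n(x,\lambda),$$ with $$\kappa(n)=\sum_{k=0}^n\frac{(-n)_k(n+a_1+b_1+a_2+b_2-1)_k(b_1)_k(a_2)_k}{(a_1+b_1)_k(b_1+a_2)_k(a_2+b_2)_k\,k!}.$$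
   Context: $(a)_n=a(a+1)\cdots(a+n-1)$. Hahn measure ($a,b>0$, integers $0\le x\le M$): $\pi(x,M,a,b)=\binom Mx\frac{(a)_x(b)_{M-x}}{(a+b)_M}$. Hahn polynomials on $\mathcal X$: $\check P_n(x,a,b)=\sum_{k=0}^n\frac{(-n)_k(n+a+b-1)_k(-x)_k}{(a)_k(-N)_k\,k!}$. *)

(* Defs.v *)
From mathcomp Require Import all_boot all_order all_algebra.

Set Implicit Arguments.
Unset Strict Implicit.
Unset Printing Implicit Defensive.

Import Order.TTheory GRing.Theory Num.Theory.
Local Open Scope ring_scope.

(* Rising factorial (a)_n = a (a + 1) ... (a + n - 1). *)
Definition poch (R : realFieldType) (a : R) (n : nat) : R :=
  \prod_(i < n) (a + i%:R).

(* The subtraction M - x is truncated; the measure is meant for x <= M. *)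
Definition hahn_measure (R : realFieldType) (x M : nat) (a b : R) : R :=
  'C(M, x)%:R * (poch a x * poch b (M - x)) / poch (a + b) M.

(* Normalised by value 1 at x = 0; meant for n <= N, where (-N)_k != 0 for all
   k <= n. *)
Definition hahn_poly (R : realFieldType) (N n x : nat) (a b : R) : R :=
  \sum_(0 <= k < n.+1)
    (poch (- n%:R) k * poch (n%:R + a + b - 1) k * poch (- x%:R) k)
      / (poch a k * poch (- N%:R) k * k`!%:R).

(* All natural-number subtractions below are exact on the summation ranges when
   x, y <= N: z2 <= x, y <= z1 <= N.  Moreover x - z2 <= z1 - z2 and
   z1 - y <= N - y. *)
Definition kernelK (R : realFieldType) (N : nat) (a1 b1 a2 b2 : R)
    (x y : nat) : R :=
  \sum_(0 <= z2 < (minn x y).+1)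
    hahn_measure z2 y a1 b1 *
    \sum_(maxn x y <= z1 < N.+1)
      hahn_measure (x - z2) (z1 - z2) b1 a2 *
      hahn_measure (z1 - y) (N - y) a2 b2.

Definition kappa (R : realFieldType) (a1 b1 a2 b2 : R) (n : nat) : R :=
  \sum_(0 <= k < n.+1)
    (poch (- n%:R) k * poch (n%:R + a1 + b1 + a2 + b2 - 1) k
       * poch b1 k * poch a2 k)
      / (poch (a1 + b1) k * poch (b1 + a2) k * poch (a2 + b2) k * k`!%:R).

(* Main.v *)
Require Import Defs.
From mathcomp Require Import all_boot all_order all_algebra.
From mathcomp Require Import ring zify.

(** Detailed balance makes the operator
    (L f)(x) = sum_y K(y, x) f(y) self-adjoint for pi(., N, lambda).  As a
    three-step Polya urn (split x, split N - x, then resplit the middle part),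
    it maps the binomials C(y, n) to combinations of the products
    C(x, k) C(N - x, n - k), so it does not raise degrees.  The Hahn polynomial
    P_n is orthogonal to all lower degrees, hence is an eigenvector of L; the
    eigenvalue is (L P_n)(0) since P_n(0) = 1, and at x = 0 only two of the urn
    steps survive, which turns the defining sum of P_n into kappa(n). *)

Set Implicit Arguments.
Unset Strict Implicit.
Unset Printing Implicit Defensive.

Import Order.TTheory GRing.Theory Num.Theory.
Local Open Scope ring_scope.

(** * Binomial sums and rising factorials *)

Section BinomialSums.

Variable R : realFieldType.
Implicit Types (a b : R) (F : nat -> R).

Lemma ffact_addn n k m : (n ^_ (k + m) = n ^_ k * (n - k) ^_ m)%N.
Proof.
elim: m => [|m IH]; first by rewrite addn0 muln1.
by rewrite addnS !ffactnSr IH subnDA mulnA.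
Qed.

Lemma sum_bin_mul N F :
  \sum_(y < N.+2) 'C(N.+1, y)%:R * (y%:R * F y) =
  N.+1%:R * \sum_(y < N.+1) 'C(N, y)%:R * F y.+1.
Proof.
rewrite big_ord_recl /= mul0r mulr0 add0r mulr_sumr.
apply: eq_bigr => i _; rewrite /bump /= add1n !mulrA -!natrM.
by rewrite mul_bin_diag mulnC.
Qed.

(** Iterated absorption y C(N + 1, y) = (N + 1) C(N, y - 1): a falling factorial is traded for a
    smaller binomial and a shift of the argument. *)
Lemma sum_bin_ffact k N F :
  \sum_(y < (N + k).+1) 'C(N + k, y)%:R * ((y ^_ k)%:R * F y) =
  ((N + k) ^_ k)%:R * \sum_(y < N.+1) 'C(N, y)%:R * F (y + k)%N.
Proof.
elim: k F => [|k IH] F.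
  rewrite addn0 ffactn0 mul1r; apply: eq_bigr => i _.
  by rewrite ffactn0 mul1r addn0.
rewrite addnS (eq_bigr (fun y : 'I_ _ =>
  'C((N + k).+1, y)%:R * (y%:R * ((y.-1 ^_ k)%:R * F y)))); last first.
  by move=> i _; rewrite ffactnS natrM -!mulrA.
rewrite (sum_bin_mul _ (fun y => (y.-1 ^_ k)%:R * F y)) /=.
rewrite (IH (fun y => F y.+1)) ffactSS natrM mulrA; congr (_ * _).
by apply: eq_bigr => i _; rewrite addnS.
Qed.

Lemma sum_bin_rev N F :
  \sum_(y < N.+1) 'C(N, y)%:R * F y = \sum_(y < N.+1) 'C(N, y)%:R * F (N - y)%N.
Proof.
rewrite (reindex_inj rev_ord_inj) /=; apply: eq_bigr => i _.
by rewrite subSS bin_sub // -ltnS.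
Qed.

Lemma sum_bin_pascal N (F : nat -> nat -> R) :
  \sum_(y < N.+2) 'C(N.+1, y)%:R * F y (N.+1 - y)%N =
  \sum_(y < N.+1) 'C(N, y)%:R * (F y.+1 (N - y)%N + F y (N - y).+1).
Proof.
rewrite big_ord_recl /= bin0 subn0 mul1r.
under eq_bigr => i _ do rewrite /bump /= add1n binS natrD mulrDl subSS.
under [RHS]eq_bigr => i _ do rewrite mulrDr.
rewrite !big_split /= addrA addrC; congr (_ + _).
rewrite big_ord_recr /= bin_small // mul0r addr0.
rewrite [RHS]big_ord_recl /= bin0 mul1r subn0; congr (_ + _).
apply: eq_bigr => i _; rewrite /bump /= add1n.
by rewrite -subSn ?subSS // ltn_ord.
Qed.

Lemma poch0 a : poch a 0 = 1.
Proof. by rewrite /poch big_ord0. Qed.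

Lemma pochSr a n : poch a n.+1 = poch a n * (a + n%:R).
Proof. by rewrite /poch big_ord_recr. Qed.

Lemma pochD a m n : poch a (m + n) = poch a m * poch (a + m%:R) n.
Proof.
elim: n => [|n IH]; first by rewrite addn0 poch0 mulr1.
by rewrite addnS !pochSr IH natrD mulrA addrA.
Qed.

Lemma poch_gt0 a n : 0 < a -> 0 < poch a n.
Proof.
move=> a0; elim: n => [|n IH]; first by rewrite poch0.
by rewrite pochSr mulr_gt0 // ltr_wpDr // ler0n.
Qed.

Lemma poch_neq0 a n : 0 < a -> poch a n != 0.
Proof. by move=> a0; rewrite gt_eqF // poch_gt0. Qed.

Lemma poch_opp_nat (x k : nat) : poch (- x%:R : R) k = (-1) ^+ k * (x ^_ k)%:R.
Proof.
elim: k => [|k IH]; first by rewrite poch0 ffactn0 mulr1.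
rewrite pochSr IH ffactnSr exprS.
have [le_kx|lt_xk] := leqP k x; first by rewrite natrM natrB //; ring.
by rewrite ffact_small // !(mul0n, mulr0, mul0r).
Qed.

(** Pascal's rule makes the inductive step multiply the i-th term by (a + i) + (b + N - i) = a + b +
    N, which is free of i. *)
Lemma poch_vandermonde a b N :
  \sum_(y < N.+1) 'C(N, y)%:R * (poch a y * poch b (N - y)) = poch (a + b) N.
Proof.
elim: N => [|N IH]; first by rewrite big_ord1 !poch0 !mulr1.
rewrite (sum_bin_pascal N (fun y z => poch a y * poch b z)).
rewrite pochSr -IH mulr_suml; apply: eq_bigr => i _.
have -> : N%:R = i%:R + (N - i)%:R :> R.
  by rewrite -natrD subnKC // -ltnS.
by rewrite !pochSr; ring.
Qed.

Lemma alternating_bin_sum N : (0 < N)%N ->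
  \sum_(k < N.+1) 'C(N, k)%:R * (-1) ^+ k = 0 :> R.
Proof.
move=> N0; have := exprDn (1 : R) (-1) N.
rewrite subrr expr0n eqn0Ngt N0 /= => E; rewrite [RHS]E.
by apply: eq_bigr => i _; rewrite expr1n mul1r mulr_natl.
Qed.

End BinomialSums.

(** * Factorial and binomial moments of the Hahn measure *)

Section HahnMean.

Variable R : realFieldType.
Implicit Types (a b : R) (F : nat -> R).

Definition hahn_mean (M : nat) a b F : R :=
  \sum_(y < M.+1) hahn_measure y M a b * F y.

Lemma eq_hahn_mean M a b F G : (forall y, (y <= M)%N -> F y = G y) ->
  hahn_mean M a b F = hahn_mean M a b G.
Proof. by move=> eqFG; apply: eq_bigr => i _; rewrite eqFG // -ltnS. Qed.

Lemma hahn_mean_sum (I : finType) (P : pred I) M a b (F : I -> nat -> R) :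
  hahn_mean M a b (fun y => \sum_(i | P i) F i y) =
  \sum_(i | P i) hahn_mean M a b (F i).
Proof.
rewrite /hahn_mean exchange_big /=; apply: eq_bigr => y _.
by rewrite mulr_sumr.
Qed.

Lemma hahn_meanZ M a b c F :
  hahn_mean M a b (fun y => c * F y) = c * hahn_mean M a b F.
Proof. by rewrite /hahn_mean mulr_sumr; apply: eq_bigr => y _; rewrite mulrCA. Qed.

(** Both falling factorials are absorbed into C(M, y). Splitting (a)_(y + k) = (a)_k (a + k)_y, and
    likewise for b, leaves a Vandermonde sum with parameters a + k and b + m. *)
Lemma hahn_mean_ffact M a b k m : 0 < a -> 0 < b ->
  hahn_mean M a b (fun y => (y ^_ k)%:R * ((M - y) ^_ m)%:R) =
  (M ^_ (k + m))%:R * (poch a k * poch b m / poch (a + b) (k + m)).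
Proof.
move=> a0 b0; have ab0 : 0 < a + b by rewrite addr_gt0.
(* If M < k + m, every y has y < k or M - y < m, so both sides vanish. *)
have [le_kmM|lt_Mkm] := leqP (k + m) M; last first.
  rewrite ffact_small // mul0r /hahn_mean big1 // => y _.
  have [lt_yk|le_ky] := ltnP y k; first by rewrite ffact_small ?mul0r ?mulr0.
  by rewrite (@ffact_small (M - y)) ?mulr0 //; have := ltn_ord y; lia.
have [L ->] : exists L, M = (L + m + k)%N by exists (M - (k + m))%N; lia.
set M' := (L + m + k)%N.
rewrite /hahn_mean; under eq_bigr => y _.
  rewrite /hahn_measure -!mulrA.
  have -> : poch a y * (poch b (M' - y) * ((poch (a + b) M')^-1 *
     ((y ^_ k)%:R * ((M' - y) ^_ m)%:R))) = (y ^_ k)%:R * ((poch a y * poch b (M' - y)) *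
     ((M' - y) ^_ m)%:R * (poch (a + b) M')^-1) by ring.
  over.
rewrite (sum_bin_ffact k (L + m) (fun y => poch a y * poch b (M' - y) *
     ((M' - y) ^_ m)%:R * (poch (a + b) M')^-1)).
rewrite (eq_bigr (fun y : 'I_(L + m).+1 => 'C(L + m, y)%:R *
  (poch a (y + k) * poch b (L + m - y) *
     ((L + m - y) ^_ m)%:R * (poch (a + b) M')^-1))); last first.
  by move=> i _; rewrite /M' subnDr.
(* Reversing the sum turns the second falling factorial into one in y, so that the same absorption
   applies again. *)
rewrite (sum_bin_rev _ (fun y => poch a (y + k) * poch b (L + m - y) *
     ((L + m - y) ^_ m)%:R * (poch (a + b) M')^-1)) (eq_bigr (fun y : 'I_(L + m).+1 => 'C(L + m, y)%:R *
  ((y ^_ m)%:R * (poch a (L + m - y + k) * poch b y *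
      (poch (a + b) M')^-1)))); last first.
  move=> i _ /=; rewrite subKn; last by rewrite -ltnS.
  by ring.
rewrite (sum_bin_ffact m L (fun y => poch a (L + m - y + k) * poch b y *
      (poch (a + b) M')^-1)).
rewrite (eq_bigr (fun y : 'I_L.+1 => 'C(L, y)%:R *
  (poch (b + m%:R) y * poch (a + k%:R) (L - y)) *
    (poch a k * poch b m / poch (a + b) M'))); last first.
  move=> i _; rewrite subnDr [(_ + k)%N]addnC [(_ + m)%N]addnC !pochD; ring.
rewrite -mulr_suml poch_vandermonde.
have -> : M' ^_ (k + m) = (M' ^_ k * (L + m) ^_ m)%N.
  by rewrite ffact_addn /M' addnK.
rewrite /M' natrM -!mulrA; congr (_ * (_ * _)).
have -> : (L + m + k = (k + m) + L)%N by lia.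
rewrite (pochD (a + b)) natrD.
have -> : b + m%:R + (a + k%:R) = a + b + (k%:R + m%:R) by ring.
have h1 := poch_neq0 (k + m) ab0.
have h2 : poch (a + b + (k%:R + m%:R)) L != 0.
  by rewrite poch_neq0 // ltr_wpDr // -natrD ler0n.
by field; rewrite h1 h2.
Qed.

Lemma hahn_mean_bin M a b k m : 0 < a -> 0 < b ->
  hahn_mean M a b (fun y => 'C(y, k)%:R * 'C(M - y, m)%:R) =
  ('C(M, k + m) * 'C(k + m, k))%:R * (poch a k * poch b m / poch (a + b) (k + m)).
Proof.
move=> a0 b0.
have f0 j : (j`!)%:R != 0 :> R by rewrite pnatr_eq0 -lt0n fact_gt0.
have binE x j : 'C(x, j)%:R = (x ^_ j)%:R / (j`!)%:R :> R.
  by apply: (mulIf (f0 j)); rewrite mulfVK // -natrM bin_ffact.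
under eq_hahn_mean => y _.
  rewrite !binE.
  have -> : (y ^_ k)%:R / k`!%:R * (((M - y) ^_ m)%:R / m`!%:R) =
    ((k`!)%:R * (m`!)%:R)^-1 * ((y ^_ k)%:R * ((M - y) ^_ m)%:R) :> R.
    by field; rewrite !f0.
  over.
rewrite hahn_meanZ hahn_mean_ffact //.
rewrite natrM (binE M).
have -> : (((k + m)`!)%:R : R) = 'C(k + m, k)%:R * (k`!)%:R * (m`!)%:R.
  rewrite -!natrM -(bin_fact (leq_addr m k)) addKn; congr (_%:R); lia.
have hC : 'C(k + m, k)%:R != 0 :> R by rewrite pnatr_eq0 -lt0n bin_gt0 leq_addr.
have hp : poch (a + b) (k + m) != 0 by rewrite poch_neq0 // addr_gt0.
by field; rewrite !f0 hC hp.
Qed.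

Lemma hahn_mean_bin1 M a b k : 0 < a -> 0 < b ->
  hahn_mean M a b (fun y => 'C(y, k)%:R) =
  'C(M, k)%:R * (poch a k / poch (a + b) k).
Proof.
move=> a0 b0; have := hahn_mean_bin M k 0 a0 b0.
rewrite addn0 binn muln1 poch0 mulr1 => <-.
by apply: eq_hahn_mean => y _; rewrite bin0 mulr1.
Qed.

Lemma hahn_measure_gt0 x M a b : (x <= M)%N -> 0 < a -> 0 < b ->
  0 < hahn_measure x M a b.
Proof.
move=> le_xM a0 b0; rewrite /hahn_measure divr_gt0 ?poch_gt0 ?addr_gt0 //.
by rewrite !mulr_gt0 ?poch_gt0 // ltr0n bin_gt0.
Qed.

Lemma hahn_measure_ge0 x M a b : 0 < a -> 0 < b -> 0 <= hahn_measure x M a b.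
Proof.
move=> a0 b0; rewrite /hahn_measure divr_ge0 //.
  by rewrite !mulr_ge0 ?ler0n // ltW // poch_gt0.
by rewrite ltW // poch_gt0 // addr_gt0.
Qed.

Lemma hahn_mean1 M a b : 0 < a -> 0 < b -> hahn_mean M a b (fun=> 1) = 1.
Proof.
move=> a0 b0; have := hahn_mean_bin1 M 0 a0 b0.
rewrite bin0 !poch0 divr1 mulr1; apply: etrans.
by apply: eq_hahn_mean => y _; rewrite bin0.
Qed.

Lemma hahn_mean0 a b F : hahn_mean 0 a b F = F 0%N.
Proof. by rewrite /hahn_mean big_ord1 /hahn_measure bin0 !poch0 !mulr1 divr1 mul1r. Qed.

End HahnMean.

(** * Falling factorials as polynomial bases, and vanishing alternating sums *)

Section FallingFactorialPoly.

Variable R : realFieldType.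

Definition ffact_poly (k : nat) : {poly R} := \prod_(i < k) ('X - (i%:R)%:P).

Lemma size_ffact_poly k : size (ffact_poly k) = k.+1.
Proof. by rewrite /ffact_poly size_prod_XsubC /index_enum -enumT size_enum_ord. Qed.

Lemma horner_ffact_poly k (x : nat) : (ffact_poly k).[x%:R] = (x ^_ k)%:R.
Proof.
elim: k => [|k IH]; first by rewrite /ffact_poly big_ord0 hornerC ffactn0.
rewrite /ffact_poly big_ord_recr /= hornerM -/(ffact_poly k) IH !hornerE ffactnSr.
have [le_kx|lt_xk] := leqP k x; first by rewrite natrM natrB.
by rewrite ffact_small // mul0n mul0r.
Qed.

Definition ffact_poly_rev (N k : nat) : {poly R} :=
  ffact_poly k \Po ((N%:R)%:P - 'X).

Lemma size_ffact_poly_rev N k : size (ffact_poly_rev N k) = k.+1.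
Proof.
rewrite /ffact_poly_rev size_comp_poly2 ?size_ffact_poly //.
by rewrite -opprB size_polyN size_XsubC.
Qed.

Lemma horner_ffact_poly_rev N k (x : nat) : (x <= N)%N ->
  (ffact_poly_rev N k).[x%:R] = ((N - x) ^_ k)%:R.
Proof.
by move=> le_xN; rewrite horner_comp !hornerE -natrB // horner_ffact_poly.
Qed.

(** Used with both x^_k and (N - x)^_k. The induction removes the top coefficient of p with a
    multiple of the last q. *)
Lemma graded_poly_basis (q : nat -> {poly R}) (p : {poly R}) d :
    (forall k, size (q k) = k.+1) -> (size p <= d)%N ->
  exists c : nat -> R, p = \sum_(k < d) c k *: q k.
Proof.
move=> sz_q; elim: d p => [|d IH] p sz_p.
  exists (fun=> 0); rewrite big_ord0; apply/eqP.
  by rewrite -size_poly_leq0.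
have qd0 : (q d)`_d != 0.
  have := lead_coef_eq0 (q d); rewrite lead_coefE sz_q /= => ->.
  by rewrite -size_poly_eq0 sz_q.
pose a := p`_d / (q d)`_d.
have [|c Ec] := IH (p - a *: q d).
  apply/leq_sizeP => j; rewrite leq_eqVlt => /orP[/eqP<-|lt_dj].
    by rewrite coefB coefZ /a divfK // subrr.
  rewrite coefB coefZ !nth_default ?mulr0 ?subr0 ?sz_q //.
  exact: leq_trans sz_p _.
exists (fun k => if k == d then a else c k).
rewrite big_ord_recr /= eqxx -[LHS](subrK (a *: q d)) Ec; congr (_ + _).
by apply: eq_bigr => i _; rewrite ltn_eqF.
Qed.

(** For p = k^_j with j < n, absorption leaves a multiple of the expansion of (1 - 1)^(n - j), whose
    exponent is positive. *)
Lemma alternating_bin_sum_poly n (p : {poly R}) : (size p <= n)%N ->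
  \sum_(k < n.+1) 'C(n, k)%:R * ((-1) ^+ k * p.[k%:R]) = 0.
Proof.
move=> /(graded_poly_basis size_ffact_poly)[c ->].
under eq_bigr => k _ do rewrite horner_sum 2!mulr_sumr.
rewrite exchange_big big1 //= => i _.
move: (nat_of_ord i) (ltn_ord i) => {i} j lt_jn.
have [L [-> L0]] : exists L, n = (L + j)%N /\ (0 < L)%N.
  by exists (n - j)%N; lia.
rewrite (eq_bigr (fun k : 'I_(L + j).+1 => 'C(L + j, k)%:R *
  ((k ^_ j)%:R * (c j * (-1) ^+ k)))); last first.
  by move=> k _; rewrite hornerZ horner_ffact_poly; ring.
rewrite (sum_bin_ffact j L (fun k => c j * (-1) ^+ k)).
rewrite (eq_bigr (fun k : 'I_L.+1 => (c j * (-1) ^+ j) *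
  ('C(L, k)%:R * (-1) ^+ k))); last first.
  by move=> k _; rewrite exprD; ring.
by rewrite -mulr_sumr alternating_bin_sum // !mulr0.
Qed.

End FallingFactorialPoly.

(** * The kernel operator: urn form, detailed balance, preservation of degree *)

Section Kernel.

Variables (R : realFieldType) (N : nat) (a1 b1 a2 b2 : R).
Hypotheses (a1_gt0 : 0 < a1) (b1_gt0 : 0 < b1).
Hypotheses (a2_gt0 : 0 < a2) (b2_gt0 : 0 < b2).

Local Notation K := (kernelK N a1 b1 a2 b2).
Local Notation A := (a1 + b1).
Local Notation B := (a2 + b2).
Local Notation pi x := (hahn_measure x N A B).

Let A_gt0 : 0 < A. Proof. exact: addr_gt0. Qed.
Let B_gt0 : 0 < B. Proof. exact: addr_gt0. Qed.
Let b1a2_gt0 : 0 < b1 + a2. Proof. exact: addr_gt0. Qed.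

(* By detailed balance the transposed kernel is K(x, y) pi(y) / pi(x), so this is
   the operator of the eigenvalue equation, divided by pi(x). *)
Definition kernel_op (f : nat -> R) (x : nat) : R := \sum_(y < N.+1) K y x * f y.

Lemma kernelK_ge0 x y : 0 <= K x y.
Proof.
apply: sumr_ge0 => z2 _; rewrite mulr_ge0 ?hahn_measure_ge0 //.
by apply: sumr_ge0 => z1 _; rewrite mulr_ge0 ?hahn_measure_ge0.
Qed.

(** The urn form: i = z2 is kept out of x, l = z1 - x is taken from N - x, and w = y - z2 is drawn
    from the middle part z1 - z2 = x + l - i. *)
Lemma kernel_op_hahn_mean (f : nat -> R) x : (x <= N)%N ->
  kernel_op f x =
  hahn_mean x a1 b1 (fun i => hahn_mean (N - x) a2 b2 (fun l =>
    hahn_mean (x + l - i) b1 a2 (fun w => f (i + w)%N))).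
Proof.
move=> le_xN.
(* The bounds min(x, y) and max(x, y) become the indicator of z2 <= y <= z1 on a range free of y,
   which allows y to be moved innermost. *)
pose T y z2 z1 := hahn_measure z2 x a1 b1 * (hahn_measure (z1 - x) (N - x) a2 b2 *
  (hahn_measure (y - z2) (z1 - z2) b1 a2 * f y)).
have KE (y : 'I_N.+1) : K y x * f y =
    \sum_(0 <= z2 < x.+1) \sum_(x <= z1 < N.+1)
      if (z2 <= y)%N && (y <= z1)%N then T y z2 z1 else 0.
  rewrite /kernelK (@big_nat_widen _ _ _ _ _ x.+1) ?ltnS ?geq_minr //.
  rewrite mulr_suml big_mkcond; apply: eq_big_nat => z2 /= lt_z2.
  have -> : (z2 < (minn y x).+1)%N = (z2 <= y)%N by lia.
  case: ifP => _ /=; last by rewrite big1.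
  rewrite (@big_nat_widenl _ _ _ _ x) ?leq_maxr // -mulrA mulr_suml mulr_sumr big_mkcond.
  apply: eq_big_nat => z1 /= /andP[le_xz1 _].
  have -> : (maxn y x <= z1)%N = (y <= z1)%N by lia.
  by case: ifP => // _; rewrite /T; ring.
rewrite /kernel_op (eq_bigr _ (fun y _ => KE y)) exchange_big /=.
rewrite /hahn_mean big_mkord; apply: eq_bigr => z2 _.
have le_z2 : (z2 <= x)%N by rewrite -ltnS.
rewrite exchange_big /= -{1}[x]add0n big_addn subSn // big_mkord mulr_sumr.
apply: eq_bigr => l _.
have le_l : (l <= N - x)%N by rewrite -ltnS.
rewrite [(l + x)%N]addnC; set z1 := (x + l)%N.
have le_z1 : (z1 <= N)%N by rewrite /z1; lia.
have le_z21 : (z2 <= z1)%N by rewrite /z1; lia.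
(* The indicator is turned back into the interval from z2 to z1, then shifted by y = w + z2. *)
rewrite -big_mkcond -(big_mkord (fun y => (z2 <= y)%N && (y <= z1)%N)
   (fun y => T y z2 z1)).
rewrite (eq_bigl (fun y => true && (z2 <= y)%N && (y < z1.+1)%N)) //.
rewrite -(@big_nat_widen _ _ _ _ z1.+1 _ (fun y => true && (z2 <= y)%N)) //.
rewrite -(@big_nat_widenl _ _ _ z2) // -{1}[nat_of_ord z2]add0n big_addn subSn // big_mkord.
rewrite !mulr_sumr; apply: eq_bigr => w _.
by rewrite /T addnK {1}/z1 addKn [(w + z2)%N]addnC.
Qed.

Lemma kernelK_sum1 y : (y <= N)%N -> \sum_(x < N.+1) K x y = 1.
Proof.
move=> le_yN; have := kernel_op_hahn_mean (fun=> 1) le_yN.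
rewrite /kernel_op; under eq_bigr do rewrite mulr1.
move=> ->; under eq_hahn_mean => i _.
  under eq_hahn_mean => l _ do rewrite hahn_mean1 //.
  rewrite hahn_mean1 //; over.
by rewrite hahn_mean1.
Qed.

(** For u = x or y, C(N, u) C(u, z2) C(N - u, z1 - u) is the multinomial coefficient with parts z2,
    u - z2, z1 - u, N - z1. Multiplied by the factorials in [D], each side becomes N! (z1 - z2)!. *)
Lemma bin_balance x y z1 z2 :
    (z2 <= x)%N -> (z2 <= y)%N -> (x <= z1)%N -> (y <= z1)%N -> (z1 <= N)%N ->
  ('C(y, z2) * 'C(z1 - z2, x - z2) * 'C(N - y, z1 - y) * 'C(N, y) =
   'C(x, z2) * 'C(z1 - z2, y - z2) * 'C(N - x, z1 - x) * 'C(N, x))%N.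
Proof.
move=> le_z2x le_z2y le_xz1 le_yz1 le_z1N.
have multi u : (z2 <= u)%N -> (u <= z1)%N ->
  ('C(N, u) * 'C(u, z2) * 'C(N - u, z1 - u) *
   (z2`! * (u - z2)`! * (z1 - u)`! * (N - z1)`!) = N`!)%N.
  move=> le_z2u le_uz1; have le_uN := leq_trans le_uz1 le_z1N.
  rewrite -(bin_fact le_uN) -(bin_fact le_z2u).
  rewrite -(@bin_fact (N - u) (z1 - u)) ?leq_sub2r //.
  have -> : (N - u - (z1 - u) = N - z1)%N by lia.
  by lia.
have single u : (z2 <= u)%N -> (u <= z1)%N ->
  ('C(z1 - z2, u - z2) * ((u - z2)`! * (z1 - u)`!) = (z1 - z2)`!)%N.
  move=> le_z2u le_uz1; rewrite -(@bin_fact (z1 - z2) (u - z2)) ?leq_sub2r //.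
  by congr (_ * (_ * _`!))%N; lia.
have := multi x le_z2x le_xz1; have := multi y le_z2y le_yz1.
have := single x le_z2x le_xz1; have := single y le_z2y le_yz1.
move=> Sy Sx My Mx.
pose D := (z2`! * (x - z2)`! * (z1 - x)`! * (y - z2)`! * (z1 - y)`! * (N - z1)`!)%N.
have D0 : (0 < D)%N by rewrite /D !muln_gt0 !fact_gt0.
apply/eqP; rewrite -(eqn_pmul2r D0) /D; apply/eqP.
transitivity (N`! * (z1 - z2)`!)%N; [rewrite -Sx -My | rewrite -Sy -Mx]; lia.
Qed.

(** Balance holds for each pair (z2, z1) separately, the summation ranges being symmetric in x and
    y. *)
Lemma kernelK_balance x y : (x <= N)%N -> (y <= N)%N ->
  K x y * pi y = K y x * pi x.
Proof.
move=> le_xN le_yN; rewrite /kernelK minnC maxnC !mulr_suml.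
apply: eq_big_nat => z2 /andP[_]; rewrite ltnS leq_min => /andP[le_z2y le_z2x].
rewrite !mulr_sumr !mulr_suml.
apply: eq_big_nat => z1 /andP[]; rewrite geq_max ltnS => /andP[le_yz1 le_xz1] le_z1N.
rewrite /hahn_measure.
have -> : (z1 - z2 - (x - z2) = z1 - x)%N by lia.
have -> : (z1 - z2 - (y - z2) = z1 - y)%N by lia.
have -> : (N - y - (z1 - y) = N - z1)%N by lia.
have -> : (N - x - (z1 - x) = N - z1)%N by lia.
have := bin_balance le_z2x le_z2y le_xz1 le_yz1 le_z1N.
move=> /(congr1 (fun n => n%:R : R)); rewrite !natrM => E.
(* What remains besides the binomials is symmetric in x and y: the normalisers (A)_y and (B)_(N - y)
   of the kernel cancel against pi(y). *)
pose W := poch a1 z2 * poch b1 (x - z2) * poch b1 (y - z2) * poch a2 (z1 - x) *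
  poch a2 (z1 - y) * poch b2 (N - z1) / poch (b1 + a2) (z1 - z2) / poch (A + B) N.
transitivity ('C(y, z2)%:R * 'C(z1 - z2, x - z2)%:R * 'C(N - y, z1 - y)%:R *
    'C(N, y)%:R * W); last rewrite E; rewrite /W; field.
all: by rewrite !poch_neq0 // addr_gt0.
Qed.

Lemma kernel_op_pi (f : nat -> R) x : (x <= N)%N ->
  \sum_(y < N.+1) K x y * pi y * f y = pi x * kernel_op f x.
Proof.
move=> le_xN; rewrite /kernel_op mulr_sumr; apply: eq_bigr => y _.
by rewrite kernelK_balance // -1?ltnS //; ring.
Qed.

Lemma kernel_op_selfadjoint (f g : nat -> R) :
  hahn_mean N A B (fun x => kernel_op f x * g x) =
  hahn_mean N A B (fun x => f x * kernel_op g x).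
Proof.
rewrite /hahn_mean.
under eq_bigr => x _ do rewrite mulrA -kernel_op_pi -1?ltnS // mulr_suml.
rewrite exchange_big; apply: eq_bigr => y _ /=.
rewrite /kernel_op !mulr_sumr; apply: eq_bigr => x _; ring.
Qed.

(** Degree less than d. Agreement is asked on 0..N only, where the truncated N - x is the value of a
    polynomial. *)
Definition is_poly_fun d (f : nat -> R) :=
  exists2 p : {poly R}, (size p <= d)%N & forall x, (x <= N)%N -> f x = p.[x%:R].

Lemma eq_is_poly_fun d (f g : nat -> R) : (forall x, (x <= N)%N -> f x = g x) ->
  is_poly_fun d g -> is_poly_fun d f.
Proof. by move=> fg [p sz_p pE]; exists p => // x le_xN; rewrite fg // pE. Qed.

Lemma is_poly_funW d e f : (d <= e)%N -> is_poly_fun d f -> is_poly_fun e f.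
Proof. by move=> le_de [p sz_p pE]; exists p => //; apply: leq_trans le_de. Qed.

Lemma is_poly_funZ d c f : is_poly_fun d f -> is_poly_fun d (fun x => c * f x).
Proof.
move=> [p sz_p pE]; exists (c *: p) => [|x le_xN]; last by rewrite hornerZ pE.
exact: leq_trans (size_scale_leq _ _) sz_p.
Qed.

Lemma is_poly_fun_sum n d (f : nat -> nat -> R) :
    (forall i, (i < n)%N -> is_poly_fun d (f i)) ->
  is_poly_fun d (fun x => \sum_(i < n) f i x).
Proof.
elim: n => [|n IH] fP.
  by exists 0 => [|x _]; rewrite ?size_poly0 // big_ord0 horner0.
have [p sz_p pE] := IH (fun i lt_in => fP i (ltnW lt_in)).
have [q sz_q qE] := fP n (ltnSn n).
exists (p + q) => [|x le_xN]; last by rewrite big_ord_recr hornerD -pE // qE.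
by apply: leq_trans (size_polyD _ _) _; rewrite geq_max sz_p.
Qed.

Lemma is_poly_fun_bin k m :
  is_poly_fun (k + m).+1 (fun x => 'C(x, k)%:R * 'C(N - x, m)%:R).
Proof.
have f0 j : (j`!)%:R != 0 :> R by rewrite pnatr_eq0 -lt0n fact_gt0.
have binE x j : 'C(x, j)%:R = (j`!)%:R^-1 * (x ^_ j)%:R :> R.
  by apply: (mulfI (f0 j)); rewrite mulVKf // -natrM mulnC bin_ffact.
apply: (@eq_is_poly_fun _ _ (fun x => ((k`!)%:R^-1 * (m`!)%:R^-1) *
   ((x ^_ k)%:R * ((N - x) ^_ m)%:R))) => [x _|]; first by rewrite !binE; ring.
apply: is_poly_funZ; exists (ffact_poly R k * ffact_poly_rev R N m) => [|x le_xN].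
  apply: leq_trans (size_polyMleq _ _) _.
  by rewrite size_ffact_poly size_ffact_poly_rev addnS.
by rewrite hornerM horner_ffact_poly horner_ffact_poly_rev.
Qed.

(** Vandermonde's convolution splits C(i + w, n) over i and w. Averaging over w gives a multiple of
    C(x - i + l, n - j), which is split again over x - i and l; the means over l and i are then
    binomial moments. *)
Lemma kernel_op_bin n x : (x <= N)%N ->
  kernel_op (fun y => 'C(y, n)%:R) x =
  \sum_(j < n.+1) \sum_(r < (n - j).+1)
    poch b1 (n - j) / poch (b1 + a2) (n - j) *
    (poch a2 (n - j - r) / poch B (n - j - r)) *
    ('C(j + r, j)%:R * (poch a1 j * poch b1 r / poch A (j + r))) *
    ('C(x, j + r)%:R * 'C(N - x, n - j - r)%:R).
Proof.
move=> le_xN; rewrite kernel_op_hahn_mean //.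
under eq_hahn_mean => i le_ix.
  under eq_hahn_mean => l _.
    under eq_hahn_mean => w _ do rewrite -binomial.Vandermonde natr_sum.
    rewrite hahn_mean_sum.
    under eq_bigr => j _.
      under eq_hahn_mean => w _ do rewrite natrM.
      rewrite hahn_meanZ hahn_mean_bin1 // addnC -addnBA // addnC.
      rewrite -binomial.Vandermonde natr_sum mulr_suml mulr_sumr.
      under eq_bigr => r _.
        rewrite natrM.
        set b := _ / _.
        have -> : 'C(i, j)%:R * ('C(x - i, r)%:R * 'C(l, n - j - r)%:R * b) =
          'C(i, j)%:R * 'C(x - i, r)%:R * b * 'C(l, n - j - r)%:R by ring.
        rewrite /b; over.
      over.
    over.
  rewrite hahn_mean_sum.
  under eq_bigr => j _.
    rewrite hahn_mean_sum.
    under eq_bigr => r _.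
      rewrite hahn_meanZ hahn_mean_bin1 //.
      set b := _ / _; set c := _ / _.
      have -> : 'C(i, j)%:R * 'C(x - i, r)%:R * b * ('C(N - x, n - j - r)%:R * c) =
        (b * c * 'C(N - x, n - j - r)%:R) * ('C(i, j)%:R * 'C(x - i, r)%:R) by ring.
      rewrite /b /c; over.
    over.
  over.
rewrite hahn_mean_sum; apply: eq_bigr => j _.
rewrite hahn_mean_sum; apply: eq_bigr => r _.
by rewrite hahn_meanZ hahn_mean_bin // natrM; ring.
Qed.

(** Each term of [kernel_op_bin] has degree (j + r) + (n - j - r) = n in x. *)
Lemma is_poly_fun_kernel_op_bin n :
  is_poly_fun n.+1 (kernel_op (fun y => 'C(y, n)%:R)).
Proof.
pose c j r := poch b1 (n - j) / poch (b1 + a2) (n - j) *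
    (poch a2 (n - j - r) / poch B (n - j - r)) *
    ('C(j + r, j)%:R * (poch a1 j * poch b1 r / poch A (j + r))).
pose f j r x : R := 'C(x, j + r)%:R * 'C(N - x, n - j - r)%:R.
apply: (@eq_is_poly_fun _ _
  (fun x => \sum_(j < n.+1) \sum_(r < (n - j).+1) c j r * f j r x)).
  by move=> x; apply: kernel_op_bin.
apply: (@is_poly_fun_sum _ _ (fun j x => \sum_(r < (n - j).+1) c j r * f j r x)).
move=> j lt_jn; apply: (@is_poly_fun_sum _ _ (fun r x => c j r * f j r x)).
move=> r lt_rn; apply: is_poly_funZ.
by apply: is_poly_funW (is_poly_fun_bin _ _); lia.
Qed.

Lemma eq_kernel_op (f g : nat -> R) x : (forall y, (y <= N)%N -> f y = g y) ->
  kernel_op f x = kernel_op g x.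
Proof. by move=> fg; apply: eq_bigr => y _; rewrite fg // -ltnS. Qed.

Lemma kernel_op_sum n (c : nat -> R) (f : nat -> nat -> R) x :
  kernel_op (fun y => \sum_(k < n) c k * f k y) x =
  \sum_(k < n) c k * kernel_op (f k) x.
Proof.
rewrite /kernel_op; under eq_bigr do rewrite mulr_sumr.
rewrite exchange_big /=; apply: eq_bigr => k _; rewrite mulr_sumr.
by apply: eq_bigr => y _; rewrite mulrCA.
Qed.

Lemma is_poly_fun_kernel_op d f : is_poly_fun d f -> is_poly_fun d (kernel_op f).
Proof.
move=> [p sz_p pE]; have [c Ep] := graded_poly_basis (size_ffact_poly R) sz_p.
apply: (@eq_is_poly_fun _ _ (fun x => \sum_(k < d) (c k * (k`!)%:R) *
    kernel_op (fun y => 'C(y, k)%:R) x)) => [x _|].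
  rewrite -(kernel_op_sum d (fun k => c k * (k`!)%:R) (fun k y => 'C(y, k)%:R)).
  apply: eq_kernel_op => y le_yN; rewrite pE // Ep horner_sum.
  apply: eq_bigr => k _; rewrite hornerZ horner_ffact_poly -bin_ffact natrM; ring.
apply: (@is_poly_fun_sum _ _ (fun k x => (c k * (k`!)%:R) *
    kernel_op (fun y => 'C(y, k)%:R) x)) => k lt_kd.
by apply: is_poly_funZ; apply: is_poly_funW (is_poly_fun_kernel_op_bin k).
Qed.

(** * Hahn polynomials: orthogonality and the eigenvalue *)

Section HahnPolynomials.

Variable n : nat.
Hypothesis le_nN : (n <= N)%N.

(** The coordinates of P_n in the basis x^_k; the sign comes from (-x)_k = (-1)^k x^_k. *)
Definition hahn_coef k : R :=
  poch (- n%:R) k * poch (n%:R + A + B - 1) k * (-1) ^+ k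
    / (poch A k * poch (- N%:R) k * k`!%:R).

Let poch_oppN_neq0 k : (k <= n)%N -> poch (- N%:R : R) k != 0.
Proof.
move=> le_kn; rewrite poch_opp_nat mulf_neq0 ?signr_eq0 //.
by rewrite pnatr_eq0 -lt0n ffact_gt0 (leq_trans le_kn).
Qed.

Let fact_neq0 k : (k`!)%:R != 0 :> R.
Proof. by rewrite pnatr_eq0 -lt0n fact_gt0. Qed.

Lemma hahn_poly_ffact x :
  hahn_poly N n x A B = \sum_(k < n.+1) hahn_coef k * (x ^_ k)%:R.
Proof.
rewrite /hahn_poly big_mkord; apply: eq_bigr => k _.
by rewrite [poch (- x%:R) k]poch_opp_nat /hahn_coef; ring.
Qed.

Definition hahnP : {poly R} := \sum_(k < n.+1) hahn_coef k *: ffact_poly R k.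

Lemma horner_hahnP (x : nat) : hahnP.[x%:R] = hahn_poly N n x A B.
Proof.
rewrite hahn_poly_ffact horner_sum; apply: eq_bigr => k _.
by rewrite hornerZ horner_ffact_poly.
Qed.

Lemma hahn_coef_top_neq0 : hahn_coef n != 0.
Proof.
rewrite /hahn_coef mulf_neq0 ?invr_eq0 //; last first.
  by rewrite !mulf_neq0 ?poch_oppN_neq0 ?fact_neq0 ?poch_neq0.
rewrite !mulf_neq0 ?signr_eq0 //.
  by rewrite poch_opp_nat mulf_neq0 ?signr_eq0 // ffactnn.
(* For n = 0 the base A + B - 1 need not be positive, but the product is empty. *)
case: (n) => [|m]; first by rewrite poch0 oner_neq0.
have -> : m.+1%:R + A + B - 1 = m%:R + A + B by rewrite -natr1; ring.
by rewrite poch_neq0 // -addrA ltr_wpDl ?ler0n ?addr_gt0.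
Qed.

Lemma hahnP_coef_top : hahnP`_n != 0.
Proof.
rewrite /hahnP big_ord_recr /= coefD coef_sum big1 ?add0r => [|k _].
  rewrite coefZ mulf_neq0 ?hahn_coef_top_neq0 //.
  have := lead_coef_eq0 (ffact_poly R n); rewrite lead_coefE size_ffact_poly /= => ->.
  by rewrite -size_poly_eq0 size_ffact_poly.
by rewrite coefZ nth_default ?mulr0 // size_ffact_poly ltn_ord.
Qed.

Lemma size_hahnP : (size hahnP <= n.+1)%N.
Proof.
apply: leq_trans (size_sum _ _ _) _; apply/bigmax_leqP => k _.
by apply: leq_trans (size_scale_leq _ _) _; rewrite size_ffact_poly.
Qed.

(* The factors in k on the right are a polynomial of degree
   m + (n - 1 - m) < n, which the alternating binomial sum of order n kills. *)
Lemma hahn_coef_moment k m : (k <= n)%N -> (m < n)%N ->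
  hahn_coef k * ((N ^_ (k + m))%:R * (poch A k * poch B m / poch (A + B) (k + m))) =
  poch B m / poch (A + B) n.-1 *
  ('C(n, k)%:R * ((-1) ^+ k *
     (((N - k) ^_ m)%:R * poch (A + B + (k + m)%:R) (n.-1 - m)))).
Proof.
move=> le_kn lt_mn; have AB0 : 0 < A + B by exact: addr_gt0.
(* (A + B)_(n - 1 + k) is split in two ways, after n - 1 factors and after k + m factors. *)
have shift : poch (n%:R + A + B - 1) k =
    poch (A + B) (k + m) * poch (A + B + (k + m)%:R) (n.-1 - m) / poch (A + B) n.-1.
  apply: (mulfI (poch_neq0 n.-1 AB0)).
  rewrite [RHS]mulrC divfK ?poch_neq0 // -pochD.
  have -> : (k + m + (n.-1 - m) = n.-1 + k)%N by lia.
  rewrite pochD; congr (_ * poch _ _).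
  have -> : n%:R = n.-1%:R + 1 :> R by rewrite natr1 prednK // (leq_ltn_trans _ lt_mn).
  by ring.
rewrite /hahn_coef shift !poch_opp_nat -bin_ffact ffact_addn !natrM.
have s2 : (-1) ^+ k * (-1) ^+ k = 1 :> R by rewrite -expr2 sqrr_sign.
have sN : (-1) ^+ k != 0 :> R by rewrite signr_eq0.
have N0 : (N ^_ k)%:R != 0 :> R.
  by rewrite pnatr_eq0 -lt0n ffact_gt0 (leq_trans le_kn).
by field; rewrite !poch_neq0 ?fact_neq0 ?sN ?N0.
Qed.

(** The test functions are (N - x)^_m with m < n, since their products with the x^_k of P_n have
    closed-form means by [hahn_mean_ffact]. *)
Lemma hahn_orthogonal f : is_poly_fun n f ->
  hahn_mean N A B (fun x => hahn_poly N n x A B * f x) = 0.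
Proof.
move=> [p sz_p pE].
have [c Ep] := graded_poly_basis (size_ffact_poly_rev R N) sz_p.
rewrite (@eq_hahn_mean _ _ _ _ _ (fun x => \sum_(m < n) c m *
   \sum_(k < n.+1) hahn_coef k * ((x ^_ k)%:R * ((N - x) ^_ m)%:R))); last first.
  move=> x le_xN; rewrite pE // Ep horner_sum mulr_sumr; apply: eq_bigr => m _.
  rewrite hornerZ horner_ffact_poly_rev // hahn_poly_ffact mulrCA mulr_suml.
  by congr (_ * _); apply: eq_bigr => k _; rewrite mulrA.
rewrite hahn_mean_sum big1 // => i _; rewrite hahn_meanZ hahn_mean_sum.
move: (nat_of_ord i) (ltn_ord i) => {i} m lt_mn.
(* As a polynomial in k, this is (N - k)^_m (A + B + k + m)_(n - 1 - m), of degree n - 1. *)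
pose q := ffact_poly_rev R N m *
  \prod_(i < n.-1 - m) ('X - (- (A + B + m%:R + i%:R))%:P).
rewrite (eq_bigr (fun k : 'I_n.+1 => (poch B m / poch (A + B) n.-1) *
   ('C(n, k)%:R * ((-1) ^+ k * q.[k%:R])))); last first.
  move=> k _; have le_kn : (k <= n)%N by rewrite -ltnS.
  rewrite hahn_meanZ hahn_mean_ffact // hahn_coef_moment //.
  rewrite /q hornerM horner_ffact_poly_rev ?(leq_trans le_kn) //.
  rewrite horner_prod; congr (_ * (_ * (_ * (_ * _)))).
  by apply: eq_bigr => i _; rewrite !hornerE natrD; ring.
rewrite -mulr_sumr alternating_bin_sum_poly ?mulr0 //.
apply: leq_trans (size_polyMleq _ _) _.
rewrite size_ffact_poly_rev size_prod_XsubC /index_enum -enumT size_enum_ord; lia.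
Qed.

(** At x = 0 the first urn step is trivial, and the two others each contribute one ratio of rising
    factorials. *)
Lemma kernel_op_ffact0 k :
  kernel_op (fun y => (y ^_ k)%:R) 0 =
  (N ^_ k)%:R * (poch b1 k * poch a2 k / (poch (b1 + a2) k * poch B k)).
Proof.
have binE x : (x ^_ k)%:R = (k`!)%:R * 'C(x, k)%:R :> R.
  by rewrite -bin_ffact natrM mulrC.
rewrite kernel_op_hahn_mean // hahn_mean0 subn0.
under eq_hahn_mean => l _.
  under eq_hahn_mean => w _ do rewrite add0n binE.
  rewrite hahn_meanZ subn0 add0n hahn_mean_bin1 // mulrCA; set b := (X in _ * X).
  rewrite mulrC /b; over.
rewrite hahn_meanZ hahn_mean_bin1 // binE.
by field; rewrite !poch_neq0.
Qed.

(** The factor N^_k from [kernel_op_ffact0] cancels (-N)_k in [hahn_coef], together with its sign;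
    hence kappa(n) is independent of N. *)
Lemma kernel_op_hahn0 : kernel_op (fun y => hahn_poly N n y A B) 0 = kappa a1 b1 a2 b2 n.
Proof.
rewrite (eq_kernel_op _ (fun y _ => hahn_poly_ffact y)).
rewrite (kernel_op_sum _ _ (fun k y => (y ^_ k)%:R)) /kappa big_mkord.
apply: eq_bigr => k _; rewrite kernel_op_ffact0 /hahn_coef.
have le_kn : (k <= n)%N by rewrite -ltnS.
have N0 : (N ^_ k)%:R != 0 :> R.
  by rewrite pnatr_eq0 -lt0n ffact_gt0 (leq_trans le_kn).
have sN : (-1) ^+ k != 0 :> R by rewrite signr_eq0.
rewrite !poch_opp_nat !addrA.
by field; rewrite !poch_neq0 ?fact_neq0 ?sN ?N0.
Qed.

Lemma hahn_poly0 : hahn_poly N n 0 A B = 1.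
Proof.
rewrite hahn_poly_ffact big_ord_recl big1 => [|k _]; last by rewrite ffact0n mulr0.
by rewrite /hahn_coef !poch0 fact0 expr0 !mulr1 addr0 divr1.
Qed.

(* Subtracting the multiple of P_n that cancels the leading term of L P_n leaves
   a remainder r of degree less than n, and <r, r> = <P_n, L r> - c <P_n, r>
   vanishes because L r also has degree less than n. *)
Lemma kernel_op_hahn x : (x <= N)%N ->
  kernel_op (fun y => hahn_poly N n y A B) x =
  kappa a1 b1 a2 b2 n * hahn_poly N n x A B.
Proof.
pose P y := hahn_poly N n y A B.
have PP : is_poly_fun n.+1 P.
  by exists hahnP => [|y _]; rewrite ?size_hahnP ?horner_hahnP.
have [q sz_q qE] := is_poly_fun_kernel_op PP.
pose c := q`_n / hahnP`_n; pose r := q - c *: hahnP.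
have rE y : (y <= N)%N -> r.[y%:R] = kernel_op P y - c * P y.
  by move=> le_yN; rewrite !hornerE qE // horner_hahnP.
have rP : is_poly_fun n (fun y => r.[y%:R]).
  exists r => //; apply/leq_sizeP => j; rewrite leq_eqVlt => /orP[/eqP<-|lt_nj].
    by rewrite coefB coefZ /c divfK ?hahnP_coef_top // subrr.
  rewrite coefB coefZ !nth_default ?mulr0 ?subr0 //.
    exact: leq_trans size_hahnP _.
  exact: leq_trans sz_q _.
have r_norm : hahn_mean N A B (fun y => r.[y%:R] ^+ 2) = 0.
  rewrite (@eq_hahn_mean _ _ _ _ _ (fun y => kernel_op P y * r.[y%:R] +
    (- c) * (P y * r.[y%:R]))); last by move=> y /rE E; rewrite expr2 {1}E; ring.
  rewrite /hahn_mean; under eq_bigr do rewrite mulrDr.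
  rewrite big_split /= -/(hahn_mean N A B (fun y => kernel_op P y * r.[y%:R])).
  rewrite -/(hahn_mean N A B (fun y => - c * (P y * r.[y%:R]))).
  rewrite (kernel_op_selfadjoint P (fun y => r.[y%:R])) hahn_meanZ.
  by rewrite !hahn_orthogonal ?mulr0 ?addr0 //; apply: is_poly_fun_kernel_op.
(* A sum of squares with positive weights vanishes only if r is zero at each point of 0..N. *)
have r0 y : (y <= N)%N -> kernel_op P y = c * P y.
  move=> le_yN; apply/eqP; rewrite -subr_eq0 -rE // -sqrf_eq0.
  have := psumr_eq0P _ r_norm => /(_ _ (Ordinal (le_yN : (y < N.+1)%N)) isT) /= H.
  have /eqP := H (fun i _ => mulr_ge0 (hahn_measure_ge0 i N A_gt0 B_gt0) (sqr_ge0 _)).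
  by rewrite mulf_eq0 gt_eqF // hahn_measure_gt0.
move=> le_xN; rewrite r0 // -kernel_op_hahn0 r0 //.
by rewrite /P hahn_poly0 mulr1.
Qed.

End HahnPolynomials.

End Kernel.

Theorem mainTheorem15 (R : realFieldType) (N : nat) (hN : (1 <= N)%N)
    (a1 b1 a2 b2 : R)
    (ha1 : 0 < a1) (hb1 : 0 < b1) (ha2 : 0 < a2) (hb2 : 0 < b2) :
  [/\ forall x y : 'I_N.+1, 0 <= kernelK N a1 b1 a2 b2 x y,
      forall y : 'I_N.+1, \sum_(x < N.+1) kernelK N a1 b1 a2 b2 x y = 1,
      forall x y : 'I_N.+1,
        kernelK N a1 b1 a2 b2 x y * hahn_measure y N (a1 + b1) (a2 + b2)
        = kernelK N a1 b1 a2 b2 y x * hahn_measure x N (a1 + b1) (a2 + b2)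
    & forall x n : 'I_N.+1,
        \sum_(y < N.+1)
          kernelK N a1 b1 a2 b2 x y * hahn_measure y N (a1 + b1) (a2 + b2)
            * hahn_poly N n y (a1 + b1) (a2 + b2)
        = kappa a1 b1 a2 b2 n * hahn_measure x N (a1 + b1) (a2 + b2)
            * hahn_poly N n x (a1 + b1) (a2 + b2)].
Proof.
split=> [x y|y|x y|x n]; first exact: kernelK_ge0.
- by apply: kernelK_sum1 => //; rewrite -ltnS.
- by apply: kernelK_balance => //; rewrite -ltnS.
(* Detailed balance moves the weight from y to x, leaving pi(x) times the operator applied to
   P_n. *)
rewrite (@kernel_op_pi _ _ _ _ _ _ ha1 hb1 ha2 hb2
  (fun y => hahn_poly N n y (a1 + b1) (a2 + b2))) -1?ltnS //.
by rewrite kernel_op_hahn -1?ltnS // -mulrA mulrCA.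
Qed.
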